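(* Let $n\ge1$ and let $p_1,\dots,p_n>0$, $q_1,\dots,q_n\ge0$ be integers. Let $G_0(t,z),\dots,G_n(t,z)\in\mathbb Z[t,z]$ be polynomials such that (i) for every $\zeta\in\mathbb C$ the polynomials $G_0(t,\zeta),\dots,G_n(t,\zeta)\in\mathbb C[t]$ are not all zero, and (ii) for every integer $t\ge0$, $\sum_{l=0}^nG_l(t,z)\,\mathcal L_n\big(p_1(t+l),q_1(t+l);\dots;p_n(t+l),q_n(t+l);z\big)=0$ identically in $z$. For $\zeta\in\mathbb C$ let $\delta_\zeta=\max_l\deg_tG_l(t,\zeta)\ (\ge0)$ and $g_l(\zeta)=\lim_{t\to\infty}G_l(t,\zeta)/t^{\delta_\zeta}$ ($l=0,\dots,n$). Let $y,v\in\mathbb C$ and $\zeta\in\mathbb C\setminus\{0,1\}$ satisfy $$\zeta\prod_{j=1}^n(y+p_j)=(\zeta-1)\prod_{j=1}^n(y-q_j)\neq0\quad\text{and}\quad v=\prod_{j=1}^n\frac{(y-q_j)^{q_j}(y+p_j)^{p_j}}{(p_j+q_j)^{p_j+q_j}}.$$ Then $g_n(\zeta)v^n+g_{n-1}(\zeta)v^{n-1}+\cdots+g_0(\zeta)=0$.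
   Context: For an integer $k\ge0$, $D_k f(u)=\frac1{k!}\frac{d^k}{du^k}f(u)$. The multiple Legendre polynomials are defined recursively by $\mathcal L_0(z)=1$ and $\mathcal L_n(p_1,q_1;\dots;p_n,q_n;z)=z^{q_n}(1-z)^{p_n}D_{p_n+q_n}\big(z^{p_n}(1-z)^{q_n}\mathcal L_{n-1}(p_1,q_1;\dots;p_{n-1},q_{n-1};z)\big)$ (differentiation in $z$). The degree of the zero polynomial is $-\infty$. *)

(* Defs.v *)
From HB Require Import structures.
From mathcomp Require Import all_boot all_order all_algebra.
From mathcomp Require Import all_classical all_reals all_analysis.
From mathcomp Require Import complex.
Set Implicit Arguments.
Unset Strict Implicit.
Unset Printing Implicit Defensive.
Import Order.TTheory GRing.Theory Num.Theory.
Import numFieldNormedType.Exports.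
Local Open Scope ring_scope.
Local Open Scope classical_set_scope.

(* 'X is the variable z; f^`N(k) is f^`(k) / k! (see nderivn_def).
   Parameters are indexed from 1: only p 1, ..., p n, q 1, ..., q n matter. *)
Fixpoint multLegendre (n : nat) (p q : nat -> nat) : {poly int} :=
  if n is m.+1 then
    'X ^+ q n * (1 - 'X) ^+ p n *
      ('X ^+ p n * (1 - 'X) ^+ q n * multLegendre m p q)^`N(p n + q n)
  else 1.

(* Z[t,z] is {poly {poly int}}: the outer variable is t, the inner one z.
   specz zeta G is G(t,zeta), a polynomial in t. *)
Definition specz (R : realType) (zeta : R[i]) (G : {poly {poly int}})
  : {poly R[i]} :=
  map_poly (fun c : {poly int} => (map_poly intr c).[zeta]) G.

(* When some G_l(t,zeta) is nonzero this is max_l deg_t G_l(t,zeta), with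
   deg 0 = -oo, since size = deg + 1 on nonzero polynomials and size 0 = 0. *)
Definition tdeg (R : realType) (n : nat)
    (G : 'I_n.+1 -> {poly {poly int}}) (zeta : R[i]) : nat :=
  (\max_(l < n.+1) size (specz zeta (G l))).-1.

Definition tlead (R : realType) (n : nat)
    (G : 'I_n.+1 -> {poly {poly int}}) (zeta : R[i]) (l : 'I_n.+1) : R[i] :=
  lim ((fun t : nat =>
    (specz zeta (G l)).[t%:R] / t%:R ^+ tdeg G zeta : R[i]^o) @ \oo).

(* Main.v *)
Require Import Defs.
From HB Require Import structures.
From mathcomp Require Import all_boot all_order all_algebra.
From mathcomp Require Import all_classical all_reals all_analysis.
From mathcomp Require Import complex.
From mathcomp Require Import zify ring.
Set Implicit Arguments.
Unset Strict Implicit.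
Unset Printing Implicit Defensive.
Import Order.TTheory GRing.Theory Num.Theory.
Import numFieldNormedType.Exports.
Local Open Scope ring_scope.

(* With u = z/(z-1) one has (1-z) L_n = sum_s T(t,s) u^s, where
   T(t,s) = prod_j 'C(p_j t + s, (p_j+q_j) t), so a recurrence in t says that
   sum_l G_l(t,U) T(t+l,s) = 0, where U is the shift s -> s-1. Dividing by
   T(t,s) turns U into a twisted shift (U f)(s) = rho(s,t) f(s-1) on rational
   functions of s and t. Write G_l(t,U) = G_l(t,w) + (U-w) H_l with
   w = zeta/(zeta-1), and filter by total degree in (s,t). On top forms,
   evaluated at s = y t, U is multiplication by prod_j (y-q_j)/(y+p_j) and
   T(t+l,s)/T(t,s) becomes v^l. Hence U - w never lowers the degree, and every
   element of its image has a top form vanishing at the saddle points y;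
   the top form of sum_l G_l(t,w) T(t+l,s)/T(t,s) is a nonzero multiple of
   t^delta sum_l g_l v^l. *)

(** * The coefficients of the multiple Legendre polynomials *)

Lemma coef_XsubC1X (R : comNzRingType) (n i : nat) :
  (('X - 1) ^+ n : {poly R})`_i = (-1) ^+ (n + i) * 'C(n, i)%:R.
Proof.
elim: n i => [|n IHn] i.
  by rewrite expr0 coef1 bin0n; case: i => [|i] /=; rewrite ?mulr1 ?mulr0 ?expr0.
rewrite exprS mulrBl mul1r coefB coefXM !IHn; case: i => [|i] /=.
  by rewrite !bin0 addn0 addn0 exprS; ring.
by rewrite binS natrD !addSn !addnS !exprS; ring.
Qed.

(** Integration by parts for the residue at 0: [D_m] moves onto [(z-1)^a z^(m-a-1)], whose image is
    ['C(a,m) (z-1)^(a-m) z^(-a-1)]. The proof compares coefficients of [g]. *)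
Lemma coef_nderivn_adjoint (R : comNzRingType) (a m : nat) (g : {poly R}) :
  (m <= a)%N ->
  (('X - 1) ^+ a * g^`N(m))`_(a - m) =
  (-1) ^+ m * 'C(a, m)%:R * (('X - 1) ^+ (a - m) * g)`_a.
Proof.
move=> le_ma; rewrite !coefMr mulr_sumr.
rewrite -[in RHS](big_mkord xpredT (fun j => (-1) ^+ m * 'C(a, m)%:R *
   ((('X - 1) ^+ (a - m) : {poly R})`_(a - j) * g`_j))).
rewrite (big_cat_nat _ (n := m)) //=; last by rewrite ltnW.
rewrite [X in _ = X + _]big_nat [X in _ = X + _]big1 ?add0r; last first.
  move=> j /andP[_ ltjm]; rewrite coef_XsubC1X (@bin_small (a - m)) ?mulr0 ?mul0r ?mulr0 //.
  lia.
rewrite -[X in _ = \big[_/_]_(X <= _ < _) _]add0n big_addn subSn // big_mkord; apply: eq_bigr => j _.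
have lejam : (j <= a - m)%N by rewrite -ltnS.
rewrite !coef_XsubC1X coef_nderivn.
have -> : (a - (j + m) = a - m - j)%N by lia.
have -> : (a - m + (a - m - j) = (a - m - j).*2 + j)%N by lia.
have -> : (a + (a - m - j) = (a - m - j).*2 + (m + j))%N by lia.
rewrite !exprD -!mul2n !exprM !sqrrN !expr1n !mul1r [(m + j)%N]addnC.
(* Both sides are the multinomial coefficient [a! / (j! m! (a-m-j)!)]. *)
have eqb : ('C(a, a - m - j) * 'C(j + m, m) = 'C(a, m) * 'C(a - m, a - m - j))%N.
  have h1 : (j + m <= a)%N by lia.
  have -> : (a - m - j = a - (j + m))%N by lia.
  rewrite bin_sub //.
  have -> : (a - (j + m) = (a - m) - j)%N by lia.
  rewrite bin_sub //.
  have := bin_fact h1; have := bin_fact (leq_addl j m); have := bin_fact le_ma.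
  have := bin_fact lejam; rewrite addnK.
  have -> : (a - m - j = a - (j + m))%N by lia.
  move: (fact_gt0 j) (fact_gt0 m) (fact_gt0 (a - m)) (fact_gt0 (a - (j + m))).
  move: (fact_gt0 (j + m)).
  set A := j`!; set B := m`!; set D := (a - m)`!; set E := (a - (j + m))`!.
  set H := (j + m)`!; move=> h0 h2 h3 h4 h5 e1 e2 e3 e4.
  have h6 : (0 < A * B * E)%N by rewrite !muln_gt0 h2 h3.
  apply/eqP; rewrite -(eqn_pmul2r h6); apply/eqP.
  transitivity (a`!).
    by rewrite -[in RHS]e4 -[in RHS]e3; ring.
  by rewrite -[in LHS]e2 -[in LHS]e1; ring.
transitivity ((-1) ^+ m * (-1) ^+ j * ('C(a, a - m - j) * 'C(j + m, m))%:R * g`_(j + m)).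
  by rewrite -mulr_natr natrM; ring.
by rewrite eqb natrM; ring.
Qed.

(** The transpose of one recursion step has the functional [L |-> [X^s] (X-1)^s L] as an
    eigenvector: the outer and inner factors are what [coef_nderivn_adjoint], with [a = p+s] and
    [m = p+q], needs to return the same functional. *)
Lemma coef_multLegendre_step (R : comNzRingType) (p q s : nat) (L : {poly R}) :
  (('X - 1) ^+ s * ('X ^+ q * (1 - 'X) ^+ p *
     ('X ^+ p * (1 - 'X) ^+ q * L)^`N(p + q)))`_s =
  'C(p + s, p + q)%:R * (('X - 1) ^+ s * L)`_s.
Proof.
set g := _ * L.
have signE k : (1 - 'X : {poly R}) ^+ k = (-1) ^+ k * ('X - 1) ^+ k.
  by rewrite -exprMn; congr (_ ^+ _); ring.
have scal k (f : {poly R}) i : ((-1) ^+ k * f)`_i = (-1) ^+ k * f`_i.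
  have -> : (-1) ^+ k = ((-1) ^+ k)%:P :> {poly R} by rewrite polyC_exp polyCN.
  by rewrite coefCM.
transitivity (('X ^+ q * ((-1) ^+ p * (('X - 1) ^+ (p + s) * g^`N(p + q))))`_s).
  by congr (polyseq _)`_s; rewrite signE exprD; ring.
rewrite coefXnM; case: ltnP => [ltsq|leqs].
  by rewrite bin_small ?mul0r // ltn_add2l.
have -> : (s - q = p + s - (p + q))%N by lia.
rewrite scal coef_nderivn_adjoint ?leq_add2l //.
have -> : (p + s - (p + q) = s - q)%N by lia.
have -> : ('X - 1) ^+ (s - q) * g = 'X ^+ p * ((-1) ^+ q * (('X - 1) ^+ s * L)).
  by rewrite /g signE -[in RHS](subnK leqs) exprD; ring.
rewrite coefXnM ltnNge leq_addr /= addKn scal.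
have sgn1 : (-1) ^+ p * (-1) ^+ (p + q) * (-1) ^+ q = 1 :> R.
  rewrite -!exprD; have -> : (p + (p + q) + q = 2 * (p + q))%N by lia.
  by rewrite exprM sqrrN !expr1n.
transitivity ((-1) ^+ p * (-1) ^+ (p + q) * (-1) ^+ q *
  ('C(p + s, p + q)%:R * (('X - 1) ^+ s * L)`_s)); last by rewrite sgn1 mul1r.
by ring.
Qed.

(* In the variable u = z/(z-1) this reads
   (1-z) L_n = sum_s prod_j 'C(p_j + s, p_j + q_j) u^s; the operators of the
   recursion are diagonal in the basis z^s / (1-z)^(s+1). *)
Lemma coef_multLegendre (n : nat) (p q : nat -> nat) (s : nat) :
  (('X - 1) ^+ s * multLegendre n p q)`_s =
  (\prod_(1 <= j < n.+1) 'C(p j + s, p j + q j))%:R.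
Proof.
elim: n => [|n IHn] /=.
  by rewrite big_nil mulr1 coef_XsubC1X binn mulr1 addnn -mul2n exprM sqrrN !expr1n.
by rewrite coef_multLegendre_step IHn [in RHS]big_nat_recr //= natrM mulrC.
Qed.

(** * The substitution z/(z-1) *)

(* (z-1)^I f(z/(z-1)), an involution on polynomials of degree at most I. *)
Definition mobius (A : comNzRingType) (I : nat) (f : {poly A}) : {poly A} :=
  \sum_(i < I.+1) f`_i *: ('X ^+ i * ('X - 1) ^+ (I - i)).

Section Mobius.
Variable A : comNzRingType.
Implicit Types f g : {poly A}.

Lemma mobius_is_linear I : linear (@mobius A I).
Proof.
move=> a f g; rewrite /mobius scaler_sumr -big_split /=; apply: eq_bigr => i _.
by rewrite coefD coefZ scalerDl scalerA.
Qed.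

HB.instance Definition _ I :=
  GRing.isLinear.Build A {poly A} {poly A} _ (@mobius A I) (mobius_is_linear I).

Lemma mobius_mulX I f : mobius I.+1 ('X * f) = 'X * mobius I f.
Proof.
rewrite /mobius big_ord_recl coefXM /= scale0r add0r mulr_sumr.
apply: eq_bigr => i _; rewrite /bump /= add1n coefXM /= subSS exprS.
by rewrite -scalerAr mulrA.
Qed.

Lemma mobius_widen I f : (size f <= I.+1)%N ->
  mobius I.+1 f = ('X - 1) * mobius I f.
Proof.
move=> sf; rewrite /mobius big_ord_recr /= (nth_default _ sf) scale0r addr0.
rewrite mulr_sumr; apply: eq_bigr => i _.
by rewrite subSn ?leq_ord // exprS -scalerAr; congr (_ *: _); ring.
Qed.

Lemma mobius_monomial i k : mobius (i + k) ('X ^+ i * ('X - 1) ^+ k) = 'X ^+ i :> {poly A}.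
Proof.
elim: i => [|i IHi]; last by rewrite exprS -mulrA mobius_mulX IHi.
rewrite mul1r; elim: k => [|k IHk].
  by rewrite expr0 /mobius big_ord1 coef1 scale1r !expr0 mulr1.
have sk : (size (('X - 1) ^+ k : {poly A}) <= k.+1)%N.
  by rewrite -polyC1 size_exp_XsubC.
rewrite exprS mulrBl mul1r linearB /= mobius_mulX mobius_widen //.
by rewrite -mulrBl -[RHS]IHk; ring.
Qed.

Lemma mobiusK I f : (size f <= I.+1)%N -> mobius I (mobius I f) = f.
Proof.
move=> sf; rewrite {2}/mobius linear_sum /= -[RHS](coefK f) poly_def.
rewrite [in RHS](big_ord_widen_cond _ xpredT (fun i => f`_i *: 'X^i) sf).
rewrite [in RHS]big_mkcond /=; apply: eq_bigr => i _.
have := mobius_monomial i (I - i); rewrite subnKC ?leq_ord // linearZ /= => ->.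
by case: ltnP => // /(nth_default _) ->; rewrite scale0r.
Qed.

Lemma size_mobius I f : (size (mobius I f) <= I.+1)%N.
Proof.
apply: (leq_trans (size_sum _ _ _)); apply/bigmax_leqP => i _.
rewrite (leq_trans (size_scale_leq _ _)) // -polyC1.
rewrite (leq_trans (size_polyMleq _ _)) // size_polyXn size_exp_XsubC.
by have := leq_ord i; lia.
Qed.

(** By [mobiusK], [f] is a combination of the [X^j (X-1)^(I-j)], and each of these moves the
    functional of index [s] to index [s-j]. Multiplication by a polynomial in [z] thus becomes a
    polynomial in the backward shift. *)
Lemma coef_mobius_pairing I s f L : (size f <= I.+1)%N -> (I <= s)%N ->
  (('X - 1) ^+ (s - I) * (f * L))`_s =
  \sum_(j < I.+1) (mobius I f)`_j * (('X - 1) ^+ (s - j) * L)`_(s - j).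
Proof.
move=> sf leIs; rewrite -{1}(mobiusK sf) {1}/mobius mulr_suml mulr_sumr coef_sum.
apply: eq_bigr => j _; rewrite -scalerAl -scalerAr coefZ; congr (_ * _).
have lejI := leq_ord j.
have -> : ('X - 1) ^+ (s - I) * ('X^j * ('X - 1) ^+ (I - j) * L) =
          'X^j * (('X - 1) ^+ (s - j) * L).
  have -> : (s - j = (s - I) + (I - j))%N by lia.
  by rewrite exprD; ring.
by rewrite coefXnM ltnNge (leq_trans lejI leIs).
Qed.

End Mobius.

Lemma horner_mobius (K : fieldType) I (f : {poly K}) (x : K) :
  (size f <= I.+1)%N -> x != 1 ->
  (x - 1) ^+ I * (mobius I f).[x / (x - 1)] = f.[x].
Proof.
move=> sf x1; have x1' : x - 1 != 0 by rewrite subr_eq0.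
rewrite (horner_coef_wide _ sf) /mobius horner_sum mulr_sumr; apply: eq_bigr => i _.
rewrite !hornerE.
have -> : x / (x - 1) - 1 = (x - 1)^-1 by field.
rewrite /= expr_div_n exprVn.
have -> : (x - 1) ^+ I = (x - 1) ^+ i * (x - 1) ^+ (I - i).
  by rewrite -exprD subnKC ?leq_ord.
by field; rewrite !expf_neq0.
Qed.

(** Additivity suffices because powers of a natural number act as integer multiples; this covers the
    coefficient functionals [mobius_coef], which are not multiplicative. *)
Lemma horner_map_additive (A B : nzRingType) (phi : {additive A -> B})
    (f : {poly A}) (t : nat) :
  (map_poly phi f).[t%:R] = phi f.[t%:R].
Proof.
rewrite (@horner_coef_wide _ (size f)) ?size_poly // horner_coef raddf_sum.
apply: eq_bigr => i _; rewrite coef_map_id0 ?raddf0 //.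
by rewrite -!natrX !mulr_natr raddfMn.
Qed.

(** A ratio of binomials with denominators cleared. The natural denominator [(M+u+v) ^_ (u+v)] is
    padded to [(M+e) ^_ e], so that several values of [u+v] share one denominator. *)
Lemma bin_ffact_shift (A M u v e : nat) :
  (M + v <= A)%N -> (u + v <= e)%N ->
  ('C(A + u, M + (u + v)) * (M + e) ^_ e =
   'C(A, M) * ((A + u) ^_ u * (A - M) ^_ v * (M + e) ^_ (e - (u + v))))%N.
Proof.
move=> leMA leue.
have e1 : ('C(A + u, M + (u + v)) * ((M + (u + v))`! * (A - M - v)`!) = (A + u)`!)%N.
  have -> : (A - M - v = A + u - (M + (u + v)))%N by lia.
  by apply: bin_fact; lia.
have e2 : ('C(A, M) * (M`! * (A - M)`!) = A`!)%N by apply: bin_fact; lia.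
have e3 : ((A - M) ^_ v * (A - M - v)`! = (A - M)`!)%N by apply: ffact_fact; lia.
have e4 : ((A + u) ^_ u * A`! = (A + u)`!)%N.
  by rewrite -[in A`!](addnK u A) ffact_fact // leq_addl.
have e5 : ((M + e) ^_ e * M`! = (M + e)`!)%N.
  by rewrite -[in M`!](addnK e M) ffact_fact // leq_addl.
have e6 : ((M + e) ^_ (e - (u + v)) * (M + (u + v))`! = (M + e)`!)%N.
  have -> : (M + (u + v) = M + e - (e - (u + v)))%N by lia.
  by rewrite ffact_fact //; lia.
have h0 : (0 < M`! * (A - M - v)`! * (M + (u + v))`!)%N by rewrite !muln_gt0 !fact_gt0.
apply/eqP; rewrite -(eqn_pmul2r h0); apply/eqP.
transitivity ((A + u)`! * (M + e)`!)%N.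
  by rewrite -[in RHS]e1 -[in RHS]e5; ring.
by rewrite -[in LHS]e4 -[in LHS]e2 -[in LHS]e3 -[in LHS]e6; ring.
Qed.

Lemma natr_ffact (A : nzRingType) (n m : nat) :
  (n ^_ m)%:R = \prod_(0 <= i < m) (n%:R - i%:R) :> A.
Proof.
elim: m => [|m IHm]; first by rewrite big_geq // ffactn0.
rewrite ffactnSr natrM IHm big_nat_recr //=; case: (leqP m n) => [/natrB ->//|ltnm].
by rewrite -IHm ffact_small // !mul0r.
Qed.

(** * Top forms of polynomials in s and t *)

(** For [k <= I], the numerator of [U^k] over the common denominator [D 0 ... D (I-1)], where
    [U f = (N 0 / D 0) * sigma f]. *)
Definition mixed_prod (A : comNzRingType) (N D : nat -> A) (I k : nat) : A :=
  \prod_(0 <= m < k) N m * \prod_(k <= m < I) D m.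

(* A denominator-free form of the division of sum_i U^i b_i by U - w, where
   U f = (N 0 / D 0) * sigma f. *)
Lemma twisted_division (A : comNzRingType) (sigma : {rmorphism A -> A})
    (N D : nat -> A) (J : nat) (b : nat -> A) (w : A) :
  (forall k, sigma (N k) = N k.+1) -> (forall k, sigma (D k) = D k.+1) ->
  sigma w = w ->
  exists h, N 0%N * sigma h - w * D J * h =
    \sum_(i < J.+2) mixed_prod N D J.+1 i * iter i sigma (b i)
    - (\sum_(i < J.+2) w ^+ i * b i) * \prod_(0 <= m < J.+1) D m.
Proof.
move=> sN sD sw.
(* The quotient in [U^i - w^i = (U - w) * sum_(k < i) w^(i-1-k) U^k], multiplied by
   [D 0 ... D (J-1)]; the inner sums then telescope. *)
exists (\sum_(i < J.+2) \sum_(0 <= k < i)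
  w ^+ (i - k.+1) * mixed_prod N D J k * iter k sigma (b i)).
rewrite rmorph_sum !mulr_sumr mulr_suml -!sumrB; apply: eq_bigr => i _.
rewrite rmorph_sum !mulr_sumr -sumrB.
pose T k := w ^+ (i - k) * mixed_prod N D J.+1 k * iter k sigma (b i).
transitivity (\sum_(0 <= k < i) (T k.+1 - T k)); last first.
  rewrite telescope_sumr // /T subnn subn0 expr0 mul1r; congr (_ - _).
  by rewrite /mixed_prod big_geq // mul1r /= mulrAC.
rewrite big_nat [RHS]big_nat; apply: eq_bigr => k /andP[_ ltki].
have lekJ : (k <= J)%N by have := ltn_ord i; lia.
rewrite !rmorphM rmorphXn sw -iterS /T.
have -> : mixed_prod N D J.+1 k.+1 = N 0%N * sigma (mixed_prod N D J k).
  rewrite /mixed_prod rmorphM !rmorph_prod mulrA; congr (_ * _).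
    by rewrite big_nat_recl //; congr (_ * _); apply: eq_bigr => m _; rewrite sN.
  by rewrite big_add1 /=; apply: eq_bigr => m _; rewrite sD.
have -> : mixed_prod N D J.+1 k = mixed_prod N D J k * D J.
  by rewrite /mixed_prod big_nat_recr //= mulrA.
have -> : (i - k = (i - k.+1).+1)%N by lia.
by rewrite exprS !rmorphM; ring.
Qed.

Lemma size_mulX_leq (R : nzRingType) (f : {poly R}) :
  (size (f * 'X)%R <= (size f).+1)%N.
Proof. by rewrite (leq_trans (size_polyMleq _ _)) // size_polyX addn2. Qed.

Section TopForm.
Variable K : fieldType.
Implicit Types (f g : {poly {poly K}}) (P Q : {poly K}) (a b c : K).

(* f(s,t), with s the outer and t the inner variable, becomes f(Y tau, tau),
   with tau the outer and Y the inner one: the coefficient of tau^d is the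
   homogeneous part of f of degree d at (Y,1). *)
Definition homogenize : {poly {poly K}} -> {poly {poly K}} :=
  horner_eval ('X%:P * 'X) \o map_poly (map_poly polyC).

Arguments homogenize : simpl never.
HB.instance Definition _ := GRing.RMorphism.copy homogenize
  (horner_eval ('X%:P * 'X) \o map_poly (map_poly polyC)).

(** [d] only bounds the total degree: [P = 0] is allowed, so top forms of a common degree can be
    added even if they cancel. *)
Definition top_form (d : nat) P f :=
  (size (homogenize f) <= d.+1)%N /\ (homogenize f)`_d = P.

Definition backshift c : {poly {poly K}} -> {poly {poly K}} :=
  comp_poly ('X - c%:P%:P).

Arguments backshift : simpl never.
HB.instance Definition _ c := GRing.RMorphism.copy (backshift c)
  (comp_poly ('X - c%:P%:P)).

Definition affine a b c : {poly {poly K}} :=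
  a%:P%:P * 'X + (b *: 'X + c%:P)%:P.

Lemma homogenizeX : homogenize 'X = 'X%:P * 'X.
Proof. by rewrite /homogenize /= map_polyX /horner_eval hornerX. Qed.

Lemma homogenizeC P : homogenize P%:P = map_poly polyC P.
Proof. by rewrite /homogenize /= map_polyC /horner_eval hornerC. Qed.

Lemma backshiftX c : backshift c 'X = 'X - c%:P%:P.
Proof. by rewrite /backshift comp_polyX. Qed.

Lemma backshiftC c P : backshift c P%:P = P%:P.
Proof. by rewrite /backshift comp_polyC. Qed.

Lemma backshift_affine e a b c : backshift e (affine a b c) = affine a b (c - e * a).
Proof.
rewrite /affine rmorphD rmorphM /= !backshiftC backshiftX !polyCD !polyCN !polyCM; ring.
Qed.

Lemma coef_homogenize f k i :
  (homogenize f)`_k`_i = if (i <= k)%N then f`_i`_(k - i) else 0.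
Proof.
elim/poly_ind: f k i => [|f P IHf] k i.
  by rewrite rmorph0 !coef0 if_same.
rewrite rmorphD rmorphM /= homogenizeX homogenizeC mulrA !coefD coefMX coefMC.
rewrite coef_map /= coefC coefMX coefC.
case: k => [|k] /=; case: i => [|i] /=; rewrite ?coef0 ?add0r ?addr0 ?subn0 //.
  by rewrite coefMX /= add0r.
by rewrite coefMX /= IHf ltnS subSS.
Qed.

(** Distinct monomials [s^i t^j] go to distinct monomials [Y^i tau^(i+j)], so nothing cancels. *)
Lemma homogenize_eq0 f : (homogenize f == 0) = (f == 0).
Proof.
apply/eqP/eqP => [f0|->]; last by rewrite rmorph0.
apply/polyP => i; apply/polyP => j; rewrite !coef0.
have := coef_homogenize f (i + j) i.
by rewrite f0 !coef0 leq_addr addKn.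
Qed.

(** Replacing [s] by [s - c] alters only parts of lower degree. The induction is on [f s + P(t)],
    where [P] is fixed by the shift. *)
Lemma size_homogenize_backshift c f d : (size (homogenize f) <= d.+1)%N ->
  (size (homogenize (backshift c f) - homogenize f)%R <= d)%N.
Proof.
elim/poly_ind: f d => [|f P IHf] d; first by rewrite !rmorph0 subr0 size_poly0.
move=> sfP.
(* Coefficients of positive degree in [Y] do not see [P], and multiplication by [s] raises the
   degree by exactly one. *)
have sf : (size (homogenize f) <= d)%N.
  apply/leq_sizeP => k ledk; apply/polyP => i; rewrite coef0.
  have /leq_sizeP/(_ k.+1 ledk)/(congr1 (fun p : {poly K} => p`_i.+1)) := sfP.
  by rewrite coef_homogenize coef0 coefD coefMX coefC /= addr0 ltnS subSS
             coef_homogenize.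
rewrite !rmorphD !rmorphM /= backshiftC backshiftX rmorphB /= homogenizeX !homogenizeC map_polyC.
case: d sf sfP => [|d] sf sfP.
  move: sf; rewrite leqn0 size_poly_eq0 homogenize_eq0 => /eqP ->.
  by rewrite !rmorph0 !mul0r subrr size_poly0.
have sS := IHf d sf.
set u := homogenize (backshift c f) in sS *; set v := homogenize f in sS sf *.
have -> : u * ('X%:P * 'X - c%:P%:P) + map_poly polyC P
  - (v * ('X%:P * 'X) + map_poly polyC P) =
  (u - v) * 'X%:P * 'X - ((u - v) + v) * c%:P%:P by ring.
apply: leq_trans (size_polyD _ _) _; rewrite geq_max size_polyN; apply/andP; split.
  apply: leq_trans (size_mulX_leq _) _.
  by rewrite ltnS mulrC mul_polyC (leq_trans (size_scale_leq _ _)).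
rewrite mulrC mul_polyC (leq_trans (size_scale_leq _ _)) //.
by rewrite (leq_trans (size_polyD _ _)) // geq_max sf (leq_trans sS).
Qed.

Lemma top_form_backshift c d P f : top_form d P f -> top_form d P (backshift c f).
Proof.
move=> [sf <-]; have sS := size_homogenize_backshift c sf.
rewrite /top_form -[homogenize (backshift c f)](subrK (homogenize f)); split.
  by rewrite (leq_trans (size_polyD _ _)) // geq_max sf (leq_trans sS).
by rewrite coefD (leq_sizeP _ _ sS) ?add0r.
Qed.

Lemma top_formD d P Q f g :
  top_form d P f -> top_form d Q g -> top_form d (P + Q) (f + g).
Proof.
move=> [sf <-] [sg <-]; split; rewrite rmorphD ?coefD //.
by rewrite (leq_trans (size_polyD _ _)) // geq_max sf.
Qed.

Lemma top_formM d e P Q f g :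
  top_form d P f -> top_form e Q g -> top_form (d + e) (P * Q) (f * g).
Proof.
move=> [sf <-] [sg <-]; split; rewrite rmorphM /=.
  by rewrite (leq_trans (size_polyMleq _ _)) // -subn1 leq_subLR
             add1n -addSn -addnS leq_add.
rewrite /= coefM.
have ltd : (d < (d + e).+1)%N by rewrite ltnS leq_addr.
rewrite (bigD1 (Ordinal ltd)) //= addKn big1 ?addr0 // => i.
rewrite -val_eqE /= neq_ltn => /orP[ltid|ltdi].
  by rewrite (leq_sizeP _ _ sg) ?mulr0 //; have := ltn_ord i; lia.
by rewrite (leq_sizeP _ _ sf) ?mul0r.
Qed.

Lemma top_formC d P : (size P <= d.+1)%N -> top_form d (P`_d)%:P P%:P.
Proof.
by move=> sP; split; rewrite homogenizeC ?coef_map ?(leq_trans (size_poly _ _)).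
Qed.

Lemma top_form_const c : top_form 0 c%:P c%:P%:P.
Proof. by have := @top_formC 0 c%:P; rewrite coefC; apply; rewrite size_polyC_leq1. Qed.

Lemma top_formN d P f : top_form d P f -> top_form d (- P) (- f).
Proof. by move=> [sf <-]; split; rewrite rmorphN ?size_polyN ?coefN. Qed.

Lemma top_form_prod (I : Type) (r : seq I) (d : I -> nat)
    (P : I -> {poly K}) (f : I -> {poly {poly K}}) :
  (forall i, top_form (d i) (P i) (f i)) ->
  top_form (\sum_(i <- r) d i)%N (\prod_(i <- r) P i) (\prod_(i <- r) f i).
Proof.
move=> tf; elim: r => [|i r IHr]; last by rewrite !big_cons; apply: top_formM.
by rewrite !big_nil -!polyC1; exact: top_form_const.
Qed.

Lemma top_form_sum (I : Type) (r : seq I) (d : nat)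
    (P : I -> {poly K}) (f : I -> {poly {poly K}}) :
  (forall i, top_form d (P i) (f i)) ->
  top_form d (\sum_(i <- r) P i) (\sum_(i <- r) f i).
Proof.
move=> tf; elim: r => [|i r IHr]; last by rewrite !big_cons; apply: top_formD.
by rewrite !big_nil; split; rewrite rmorph0 ?size_poly0 ?coef0.
Qed.

Lemma top_form_affine a b c : top_form 1 (a *: 'X + b%:P) (affine a b c).
Proof.
rewrite /affine; apply: top_formD.
  rewrite -mul_polyC -[1%N]/(0 + 1)%N; apply: top_formM; first exact: top_form_const.
  split; rewrite homogenizeX ?coefMX ?coefC //=.
  by rewrite (leq_trans (size_mulX_leq _)) // ltnS size_polyC_leq1.
have -> : b%:P = ((b *: 'X + c%:P)`_1)%:P by rewrite coefD coefZ coefX coefC /= mulr1 addr0.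
apply: top_formC; rewrite (leq_trans (size_polyD _ _)) // geq_max.
by rewrite (leq_trans (size_scale_leq _ _)) ?size_polyX // (leq_trans (size_polyC_leq1 _)).
Qed.

Lemma top_form_uniq d e P Q f :
  top_form d P f -> top_form e Q f -> P != 0 -> Q != 0 -> P = Q.
Proof.
have leadE k R : top_form k R f -> R != 0 -> lead_coef (homogenize f) = R.
  move=> [sf <-] R0; rewrite lead_coefE.
  have /eqP -> // : size (homogenize f) == k.+1.
  by rewrite eqn_leq sf ltnNge; apply: contra R0 => /leq_sizeP ->.
by move=> /leadE Pf /leadE Qf /Pf <- /Qf.
Qed.

Lemma top_form_exists f : f != 0 -> exists d P, top_form d P f /\ P != 0.
Proof.
rewrite -homogenize_eq0 => f0.
exists (size (homogenize f)).-1, (lead_coef (homogenize f)).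
by rewrite lead_coef_eq0; split=> //; split; rewrite ?leqSpred.
Qed.

(* The top form of N h(s-1) - w D h is (Nt - w Dt) times that of h: no
   cancellation occurs, while Nt - w Dt vanishes at y. *)
Lemma top_form_vanishes (N D b : nat -> {poly {poly K}}) (J n d : nat)
    (Nt Dt P : {poly K}) (w y : K) :
  (forall k, backshift 1 (N k) = N k.+1) -> (forall k, backshift 1 (D k) = D k.+1) ->
  top_form n Nt (N 0%N) -> (forall k, top_form n Dt (D k)) ->
  Nt != w%:P * Dt -> Nt.[y] = w * Dt.[y] -> Dt.[y] != 0 ->
  \sum_(i < J.+2) mixed_prod N D J.+1 i * iter i (backshift 1) (b i) = 0 ->
  top_form d P (\sum_(i < J.+2) w%:P%:P ^+ i * b i) ->
  P.[y] = 0.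
Proof.
move=> sN sD tN tD NtDt eqy Dy0 sum0 tb.
have [h] := twisted_division J b sN sD (backshiftC 1 w%:P).
rewrite sum0 sub0r; set beta := \sum_(i < _) _ in tb * => eq_h.
have [->|P0] := eqVneq P 0; first by rewrite horner0.
have Dt0 : Dt != 0 by apply: contraNneq Dy0 => ->; rewrite horner0.
(* By [sum0] the right-hand side of the division is [- beta] times the product of the [D m]; its top
   form is nonzero since [P] is. *)
have tR := top_formN (top_formM tb (top_form_prod (index_iota 0 J.+1) tD)).
have PDt0 : - (P * \prod_(0 <= m < J.+1) Dt) != 0.
  by rewrite oppr_eq0 mulf_neq0 // prodr_const_nat expf_neq0.
have h0 : h != 0.
  apply: contraNneq PDt0 => h0; move: tR; rewrite -eq_h h0 rmorph0 !mulr0 subr0.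
  by case=> _ <-; rewrite rmorph0 coef0.
have [e [Q [th Q0]]] := top_form_exists h0.
have tL : top_form (n + e) (Nt * Q - w%:P * Dt * Q)
    (N 0%N * backshift 1 h - w%:P%:P * D J * h).
  apply: top_formD; first by apply: top_formM => //; apply: top_form_backshift.
  apply/top_formN/top_formM => //.
  by rewrite -[n]add0n; apply: top_formM; first exact: top_form_const.
rewrite -mulrBl eq_h in tL.
(* Both factors are nonzero, so this is the true leading part of the left side. Uniqueness equates
   it with that of the right side, and it vanishes at [y]. *)
have LQ0 : (Nt - w%:P * Dt) * Q != 0 by rewrite mulf_neq0 // subr_eq0.
have := top_form_uniq tL tR LQ0 PDt0.
move=> /(congr1 (fun p => p.[y])); rewrite !hornerE eqy subrr mul0r.
move=> /esym/eqP; rewrite oppr_eq0 mulf_eq0 prodr_const_nat horner_exp.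
by rewrite expf_eq0 (negPf Dy0) andbF orbF => /eqP.
Qed.

End TopForm.

(** * The hypergeometric term *)

Section HypergeometricTerm.
Variables (K : numFieldType) (n : nat) (p q : nat -> nat).
Implicit Types (f : {poly {poly K}}) (s t k l : nat).

Definition eval2 (s t : K) : {poly {poly K}} -> K :=
  horner_eval t \o horner_eval s%:P.
Arguments eval2 : simpl never.

HB.instance Definition _ (s t : K) := GRing.RMorphism.copy (eval2 s t)
  (horner_eval t \o horner_eval s%:P).

Lemma eval2C (s t : K) (g : {poly K}) : eval2 s t g%:P = g.[t].
Proof. by rewrite /eval2 /= /horner_eval hornerC. Qed.

Lemma eval2_affine (s t a b c : K) :
  eval2 s t (affine a b c) = a * s + b * t + c.
Proof. by rewrite /eval2 /= /horner_eval /affine !hornerE ?addrA. Qed.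

Lemma eval2_backshift (s t c : K) f : eval2 s t (backshift c f) = eval2 (s - c) t f.
Proof.
by rewrite /eval2 /= /horner_eval /backshift horner_comp !hornerE -polyCB.
Qed.

Lemma eval2_iter_backshift (s t : K) k f :
  eval2 s t (iter k (backshift 1) f) = eval2 (s - k%:R) t f.
Proof.
elim: k s => [|k IHk] s; first by rewrite subr0.
by rewrite iterS eval2_backshift IHk -addrA -opprD -natr1 [1 + _]addrC.
Qed.

Lemma poly_eq0_large_nat (g : {poly K}) (S : nat) :
  (forall s, (S <= s)%N -> g.[s%:R] = 0) -> g = 0.
Proof.
move=> g0; apply: (@roots_geq_poly_eq0 _ g [seq (S + i)%:R | i <- iota 0 (size g)]).
- by apply/allP => _ /mapP[i _ ->]; apply/eqP/g0/leq_addr.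
- by rewrite map_inj_uniq ?iota_uniq // => i j /eqP; rewrite eqr_nat eqn_add2l => /eqP.
- by rewrite size_map size_iota.
Qed.

(** The threshold in [s] may depend on [t]: for fixed [t], large [s] kill every coefficient in [s],
    and each coefficient then vanishes at all natural [t]. *)
Lemma eval2_eq0_large_nat f (S : nat -> nat) :
  (forall s t, (S t <= s)%N -> eval2 s%:R t%:R f = 0) -> f = 0.
Proof.
move=> f0; apply/polyP => i; rewrite coef0.
apply: (@poly_eq0_large_nat _ 0) => t _.
have : map_poly (horner_eval t%:R) f = 0.
  apply: (@poly_eq0_large_nat _ (S t)) => s leSs; rewrite -[RHS](f0 s t leSs).
  have {1}-> : s%:R = horner_eval t%:R (s%:R%:P) :> K by rewrite /horner_eval hornerC.
  by rewrite horner_map.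
by move/(congr1 (fun g : {poly K} => g`_i)); rewrite coef_map coef0.
Qed.

(** The [T(t,s)] of the overview, given by [coef_multLegendre] for the parameters [p j * t] and
    [q j * t]. *)
Definition bin_prod t s : nat :=
  \prod_(1 <= j < n.+1) 'C(p j * t + s, p j * t + q j * t).

(* bin_prod t s / bin_prod t (s - 1) = denom 0 / numer 0, both shifted k
   times in s. *)
Definition numer k : {poly {poly K}} :=
  \prod_(1 <= j < n.+1) affine 1 (- (q j)%:R) (- k%:R).
Definition denom k : {poly {poly K}} :=
  \prod_(1 <= j < n.+1) affine 1 (p j)%:R (- k%:R).

Lemma backshift_numer k : backshift 1 (numer k) = numer k.+1.
Proof.
rewrite /numer rmorph_prod; apply: eq_bigr => j _.
by rewrite /= backshift_affine mulr1 -opprD natr1.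
Qed.

Lemma backshift_denom k : backshift 1 (denom k) = denom k.+1.
Proof.
rewrite /denom rmorph_prod; apply: eq_bigr => j _.
by rewrite /= backshift_affine mulr1 -opprD natr1.
Qed.

(** A crude common bound for the [q j * t]; from it on, every binomial in [bin_prod t s] is
    nonzero. *)
Definition support_bound t : nat := \sum_(1 <= j < n.+1) q j * t.

Lemma leq_support_bound t j : (1 <= j < n.+1)%N -> (q j * t <= support_bound t)%N.
Proof.
move=> jn; rewrite /support_bound (bigD1_seq j) ?iota_uniq ?mem_index_iota //=.
exact: leq_addr.
Qed.

Lemma bin_prod_gt0 t s : (support_bound t <= s)%N -> (0 < bin_prod t s)%N.
Proof.
move=> les; rewrite /bin_prod big_nat; apply: prodn_cond_gt0 => j jn.
by rewrite bin_gt0 leq_add2l (leq_trans (leq_support_bound t jn)).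
Qed.

(** Factor by factor this is [a 'C(a-1, b) = (a - b) 'C(a, b)] with [a = p j * t + s - k]. *)
Lemma bin_prod_step t s k : (k < s)%N -> (support_bound t + k < s)%N ->
  (bin_prod t (s - k.+1))%:R * eval2 s%:R t%:R (denom k) =
  (bin_prod t (s - k))%:R * eval2 s%:R t%:R (numer k).
Proof.
move=> ltks lts; rewrite /bin_prod !natr_prod !rmorph_prod -!big_split /=.
rewrite big_nat [RHS]big_nat; apply: eq_bigr => j jn.
have leq := leq_support_bound t jn.
rewrite !eval2_affine !mul1r mulNr.
have -> : s%:R + (p j)%:R * t%:R - k%:R = (p j * t + (s - k))%:R :> K.
  by rewrite natrD natrM natrB 1?ltnW //; ring.
have -> : s%:R - (q j)%:R * t%:R - k%:R =
          (p j * t + (s - k) - (p j * t + q j * t))%:R :> K.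
  by rewrite subnDl !natrB ?natrM; [ring|lia|lia].
rewrite -!natrM; congr (_%:R); rewrite [RHS]mulnC -mul_bin_down mulnC.
congr (_ * 'C(_, _))%N; lia.
Qed.

Lemma bin_prod_shift t s I k : (k <= I)%N -> (support_bound t + I <= s)%N ->
  (bin_prod t (s - k))%:R * eval2 s%:R t%:R (\prod_(0 <= m < I) denom m) =
  (bin_prod t s)%:R * eval2 s%:R t%:R (mixed_prod numer denom I k).
Proof.
move=> leI les; rewrite (big_cat_nat _ leI) //= /mixed_prod !rmorphM /= !mulrA.
congr (_ * _); elim: k leI => [|k IHk] leI; first by rewrite !big_geq ?subn0.
rewrite !big_nat_recr //= !rmorphM /= [LHS]mulrCA bin_prod_step; [|lia|lia].
by rewrite [LHS]mulrCA [LHS]mulrA (IHk (ltnW leI)) -[LHS]mulrA.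
Qed.

(** [T(t+l,s) / T(t,s)] times [shift_ratio_denom t]. The third product is the padding that makes the
    denominator the same for all [l <= n]. *)
Definition shift_ratio l : {poly {poly K}} :=
  \prod_(1 <= j < n.+1)
    (\prod_(0 <= i < p j * l) affine 1 (p j)%:R ((p j * l)%:R - i%:R) *
     \prod_(0 <= i < q j * l) affine 1 (- (q j)%:R) (- i%:R) *
     \prod_(0 <= i < (p j + q j) * (n - l))
       affine 0 (p j + q j)%:R (((p j + q j) * n)%:R - i%:R)).

Definition shift_ratio_denom t : nat :=
  \prod_(1 <= j < n.+1)
     ((p j + q j) * t + (p j + q j) * n) ^_ ((p j + q j) * n).

(** For each [j] this is [bin_ffact_shift] with [A = p j * t + s], [M = (p j + q j) * t],
    [u = p j * l], [v = q j * l], [e = (p j + q j) * n]. *)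
Lemma bin_prod_shift_t t s l : (l <= n)%N -> (support_bound (t + n) <= s)%N ->
  (bin_prod (t + l) s)%:R * (shift_ratio_denom t)%:R =
  (bin_prod t s)%:R * eval2 s%:R t%:R (shift_ratio l).
Proof.
move=> leln les; rewrite /bin_prod /shift_ratio_denom /shift_ratio.
rewrite !natr_prod !rmorph_prod -!big_split /=.
rewrite big_nat [RHS]big_nat; apply: eq_bigr => j jn.
have leq := leq_trans (leq_support_bound (t + n) jn) les.
have leql : (q j * l <= q j * n)%N by rewrite leq_mul2l leln orbT.
rewrite 2!(rmorphM (eval2 s%:R t%:R)) 3!(rmorph_prod (eval2 s%:R t%:R)) /=.
set A := (p j * t + s)%N; set M := (p j * t + q j * t)%N.
have -> : ((p j + q j) * t = M)%N by rewrite mulnDl.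
set e := ((p j + q j) * n)%N.
have -> : \prod_(0 <= i < p j * l)
    eval2 s%:R t%:R (affine 1 (p j)%:R ((p j * l)%:R - i%:R)) =
    ((A + p j * l) ^_ (p j * l))%:R.
  by rewrite natr_ffact; apply: eq_bigr => i _; rewrite eval2_affine /A; ring.
have -> : \prod_(0 <= i < q j * l)
    eval2 s%:R t%:R (affine 1 (- (q j)%:R) (- i%:R)) = ((A - M) ^_ (q j * l))%:R.
  rewrite natr_ffact; apply: eq_bigr => i _; rewrite eval2_affine /A /M natrB.
    by ring.
  by rewrite leq_add2l; move: leq; rewrite mulnDr; lia.
have -> : \prod_(0 <= i < (p j + q j) * (n - l))
    eval2 s%:R t%:R (affine 0 (p j + q j)%:R (e%:R - i%:R)) =
    ((M + e) ^_ (e - (p j * l + q j * l)))%:R.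
  rewrite natr_ffact -mulnDl /e -mulnBr.
  by apply: eq_bigr => i _; rewrite eval2_affine /M /e; ring.
rewrite -!natrM; congr (_%:R).
rewrite -[RHS]bin_ffact_shift.
- by congr ('C(_, _) * _)%N; rewrite /A /M; lia.
- by rewrite /A /M; move: leq; rewrite mulnDr; lia.
- by rewrite -mulnDl /e leq_mul2l leln orbT.
Qed.

End HypergeometricTerm.

(** * Leading coefficients *)

Section TLimits.
Local Open Scope classical_set_scope.

Lemma cvg_complex_invn (R : realType) :
  ((fun t : nat => (t.+1%:R)^-1 : R[i]^o) @ \oo --> (0 : R[i]^o)).
Proof.
apply/cvgrPdist_lt => e e0.
have : (0 < complex.Re e) by move: e0; rewrite ltcE /= => /andP[].
(* A positive element of [R[i]] is real, which reduces the claim to the real sequence. *)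
have eR : e = (complex.Re e)%:C%C.
  by move: e0; case: e => a b; rewrite ltcE /= => /andP[/eqP -> _].
move=> r0; near=> t.
rewrite sub0r normrN normfV ger0_norm ?ler0n // eR.
have -> : (t.+1%:R : R[i]) = (t.+1%:R : R)%:C%C by rewrite rmorph_nat.
rewrite -(fmorphV (real_complex R)) ltcR.
near: t; exact: near_infty_natSinv_lt (PosNum r0).
Unshelve. all: by end_near. Qed.

Lemma cvg_poly_div_expn (R : realType) (d : nat) (F : {poly R[i]}) :
  (size F <= d.+1)%N ->
  ((fun t : nat => F.[t%:R] / t%:R ^+ d : R[i]^o) @ \oo --> (F`_d : R[i]^o)).
Proof.
(* Shifting the index avoids the default value of the quotient at [t = 0]. *)
move=> sF; rewrite -(@cvg_shiftS (R[i]^o)).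
elim: d F sF => [|d IHd] F.
  move=> /size1_polyC ->; rewrite coefC /=.
  under eq_fun do rewrite hornerC expr0 divr1.
  exact: cvg_cst.
elim/poly_ind: F => [|F c _] sF.
  under eq_fun do rewrite horner0 mul0r.
  by rewrite coef0; exact: cvg_cst.
have sF' : (size F <= d.+1)%N.
  have [->|F0] := eqVneq F 0; first by rewrite size_poly0.
  by move: sF; rewrite size_MXaddC (negPf F0).
rewrite coefD coefMX coefC /= addr0 -[F`_d]addr0.
have -> : (fun n : nat => (F * 'X + c%:P).[n.+1%:R] / n.+1%:R ^+ d.+1 : R[i]^o) =
   (fun n : nat => F.[n.+1%:R] / n.+1%:R ^+ d + c * (n.+1%:R^-1) ^+ d.+1 : R[i]^o).
  apply/funext => n; rewrite hornerMXaddC mulrDl exprVn; congr (_ + _).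
  by rewrite exprSr invfM mulrACA divff ?mulr1 // pnatr_eq0.
apply: cvgD; first exact: IHd.
rewrite -[X in _ --> X](mulr0 c).
apply: cvgM; first exact: cvg_cst.
elim: d {IHd sF sF'} => [|k IHk]; first exact: cvg_complex_invn.
rewrite -[X in _ --> X](mulr0 0).
under eq_fun do rewrite exprS.
by apply: cvgM; [exact: cvg_complex_invn|exact: IHk].
Qed.

Lemma tleadE (R : realType) (n : nat)
    (G : 'I_n.+1 -> {poly {poly int}}) (zeta : R[i]) (l : 'I_n.+1) :
  tlead G zeta l = (specz zeta (G l))`_(tdeg G zeta).
Proof.
apply: (@cvg_lim (R[i]^o)); first exact: norm_hausdorff.
apply: cvg_poly_div_expn; rewrite /tdeg.
by apply: leq_trans (leqSpred _); exact: leq_bigmax.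
Qed.

End TLimits.

(** * The theorem *)

Lemma top_form_prod_affine (K : fieldType) (a b : K) (c : nat -> K) (m : nat) :
  top_form m ((a *: 'X + b%:P) ^+ m) (\prod_(0 <= i < m) affine a b (c i)).
Proof.
have := top_form_prod (index_iota 0 m) (fun i => top_form_affine a b (c i)).
by rewrite sum_nat_const_nat prodr_const_nat subn0 muln1.
Qed.

(** The padding makes the degree independent of [l], so the terms for different [l] can be added at
    a single degree. *)
Lemma top_form_shift_ratio (K : numFieldType) (n : nat) (p q : nat -> nat) (l : nat) :
  (l <= n)%N ->
  top_form (\sum_(1 <= j < n.+1) (p j + q j) * n)
    (\prod_(1 <= j < n.+1)
      (('X + (p j)%:R%:P) ^+ (p j * l) * ('X - (q j)%:R%:P) ^+ (q j * l) *
       (p j + q j)%:R%:P ^+ ((p j + q j) * (n - l))))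
    (shift_ratio K n p q l).
Proof.
move=> leln; apply: top_form_prod => j.
have -> : ((p j + q j) * n = p j * l + q j * l + (p j + q j) * (n - l))%N.
  by rewrite -mulnDl -mulnDr subnKC.
apply: top_formM; first apply: top_formM.
- by rewrite -['X]scale1r; apply: top_form_prod_affine.
- by rewrite -['X]scale1r -polyCN; apply: top_form_prod_affine.
- rewrite -[_%:P]add0r -[0](scale0r 'X); exact: top_form_prod_affine.
Qed.

Lemma map_mobius (A B : comNzRingType) (f : {rmorphism A -> B}) I (c : {poly A}) :
  map_poly f (mobius I c) = mobius I (map_poly f c).
Proof.
rewrite /mobius rmorph_sum; apply: eq_bigr => i _ /=.
by rewrite map_polyZ coef_map rmorphM !rmorphXn rmorphB rmorph1 /= map_polyX.
Qed.

Lemma size_horner_nat (A : nzRingType) (g : {poly {poly A}}) (d t : nat) :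
  (forall k, (size (g`_k)%R <= d)%N) -> (size (g.[t%:R])%R <= d)%N.
Proof.
move=> sg; rewrite horner_coef; apply: (leq_trans (size_sum _ _ _)).
apply/bigmax_leqP => k _; rewrite -natrX mulr_natr -scaler_nat.
exact: leq_trans (size_scale_leq _ _) (sg k).
Qed.

Definition mobius_coef (K : numFieldType) (I j : nat) : {additive {poly int} -> K} :=
  intr \o (coefp j \o @mobius int I).

(** * From the recurrence in [t] to a polynomial identity in [s] and [t] *)

Section Recurrence.
Variables (K : numFieldType) (n : nat) (p q : nat -> nat).
Variables (G : 'I_n.+1 -> {poly {poly int}}) (I : nat).
Hypothesis sG : forall l k, (size ((G l)`_k)%R <= I.+1)%N.
Hypothesis hGrec : forall t : nat,
  \sum_(l < n.+1) (G l).[t%:R] *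
    multLegendre n (fun j => p j * (t + l))%N (fun j => q j * (t + l))%N = 0.

Let c (l : 'I_n.+1) (j : nat) : {poly K} := map_poly (mobius_coef K I j) (G l).

(** Apply [[X^s] (X-1)^(s-I)] to the recurrence: [coef_mobius_pairing] turns the [G_l] into shifts
    of [s], and [coef_multLegendre] evaluates the rest. *)
Lemma bin_prod_recurrence t s : (I <= s)%N ->
  \sum_(j < I.+1) \sum_(l < n.+1)
    (c l j).[t%:R] * (bin_prod n p q (t + l) (s - j))%:R = 0.
Proof.
move=> leIs.
have := congr1 (fun f : {poly int} => ((('X - 1) ^+ (s - I) * f)`_s)%:~R : K) (hGrec t).
rewrite mulr0 coef0 rmorph0 mulr_sumr coef_sum rmorph_sum exchange_big => eq0.
rewrite -[RHS]eq0.
apply: eq_bigr => l _; rewrite coef_mobius_pairing ?size_horner_nat // rmorph_sum.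
apply: eq_bigr => j _; rewrite coef_multLegendre rmorphM /= rmorph_nat.
by rewrite /c horner_map_additive.
Qed.

(** The recurrence divided by [T(t,s)], with the denominators of the ratios in [s] and in [t]
    cleared. *)
Lemma bin_prod_identity :
  \sum_(j < I.+1) mixed_prod (numer K n q) (denom K n p) I j *
    iter j (backshift 1) (\sum_(l < n.+1) (c l j)%:P * shift_ratio K n p q l) = 0.
Proof.
(* The threshold keeps [s - j], for all [j <= I], above the support bound at [t + n], as
   [bin_prod_shift_t] requires. *)
apply: (@eval2_eq0_large_nat _ _ (fun t => support_bound n q (t + n) + I)%N) => s t les.
have les' : (support_bound n q t + I <= s)%N.
  apply: leq_trans les; rewrite leq_add2r /support_bound.
  by apply: leq_sum => j _; rewrite leq_mul2l leq_addr orbT.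
have T0 : (bin_prod n p q t s)%:R != 0 :> K.
  by rewrite pnatr_eq0 -lt0n bin_prod_gt0 // (leq_trans (leq_addr I _)).
apply: (mulfI T0); rewrite mulr0 rmorph_sum mulr_sumr.
transitivity (eval2 s%:R t%:R (\prod_(0 <= m < I) denom K n p m) *
   (shift_ratio_denom n p q t)%:R *
   \sum_(j < I.+1) \sum_(l < n.+1)
      (c l j).[t%:R] * (bin_prod n p q (t + l) (s - j))%:R); last first.
  by rewrite bin_prod_recurrence ?mulr0 // (leq_trans (leq_addl _ _) les).
rewrite mulr_sumr; apply: eq_bigr => j _.
have lejI : (j <= I)%N := leq_ord j.
rewrite [X in _ * X = _]rmorphM /= mulrA -bin_prod_shift //.
rewrite eval2_iter_backshift -natrB; last by lia.
rewrite rmorph_sum !mulr_sumr; apply: eq_bigr => l _.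
rewrite [X in _ * X = _]rmorphM /= eval2C.
have ratio : (bin_prod n p q (t + l) (s - j))%:R * (shift_ratio_denom n p q t)%:R =
    (bin_prod n p q t (s - j))%:R *
    eval2 (s - j)%:R t%:R (shift_ratio K n p q l) :> K.
  by apply: bin_prod_shift_t; [exact: leq_ord|lia].
move: (eval2 _ _ _) (eval2 _ _ _) (_.[_]) ratio => d e g ratio.
transitivity (d * g * ((bin_prod n p q t (s - j))%:R * e)); first by ring.
by rewrite -ratio; ring.
Qed.

End Recurrence.

(** [horner_mobius] applied to each coefficient in [t]: setting [U] to [w] recovers [G(t,zeta)] up
    to a nonzero power of [zeta - 1]. *)
Lemma specz_mobius (R : realType) (zeta : R[i]) (I : nat) (g : {poly {poly int}}) :
  (forall k, (size (g`_k)%R <= I.+1)%N) -> zeta != 1 ->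
  specz zeta g = (zeta - 1) ^+ I *: \sum_(j < I.+1)
    (zeta / (zeta - 1)) ^+ j *: map_poly (mobius_coef R[i] I j) g.
Proof.
move=> sg z1; apply/polyP => k.
rewrite coefZ coef_sum /specz coef_map_id0; last by rewrite rmorph0 horner0.
rewrite -(@horner_mobius _ I) //; last by rewrite (leq_trans (size_poly _ _)).
congr (_ * _); rewrite -map_mobius (@horner_coef_wide _ I.+1); last first.
  by rewrite (leq_trans (size_poly _ _)) ?size_mobius.
by apply: eq_bigr => j _; rewrite coefZ !coef_map_id0 ?raddf0 // mulrC.
Qed.

Theorem theorem5p1 (R : realType) (n : nat) (p q : nat -> nat)
  (G : 'I_n.+1 -> {poly {poly int}})
  (hn : (1 <= n)%N)
  (hp : forall j : nat, (1 <= j <= n)%N -> (0 < p j)%N)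
  (hG0 : forall zeta : R[i], exists l : 'I_n.+1, specz zeta (G l) != 0)
  (hGrec : forall t : nat,
     \sum_(l < n.+1) (G l).[t%:R] *
       multLegendre n (fun j => p j * (t + l))%N (fun j => q j * (t + l))%N = 0)
  (y v zeta : R[i])
  (hzeta0 : zeta != 0) (hzeta1 : zeta != 1)
  (hy : zeta * \prod_(1 <= j < n.+1) (y + (p j)%:R)
        = (zeta - 1) * \prod_(1 <= j < n.+1) (y - (q j)%:R))
  (hy0 : (zeta - 1) * \prod_(1 <= j < n.+1) (y - (q j)%:R) != 0)
  (hv : v = \prod_(1 <= j < n.+1)
     ((y - (q j)%:R) ^+ q j * (y + (p j)%:R) ^+ p j
       / ((p j + q j)%N%:R ^+ (p j + q j)))) :
  \sum_(l < n.+1) tlead G zeta l * v ^+ l = 0.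
Proof.
have z1 : zeta - 1 != 0 by rewrite subr_eq0.
pose mz (l : 'I_n.+1) := (\max_(k < size (G l)) size ((G l)`_k)%R)%N.
(* A uniform bound on degrees in [z], used generously: degree [J + 1] is always positive, the form
   in which the division by [U - w] is stated. *)
pose J := (\max_(l < n.+1) mz l)%N.
have sG l k : (size ((G l)`_k)%R <= J.+2)%N.
  case: (ltnP k (size (G l))) => [ltk|/(nth_default _) ->]; last by rewrite size_poly0.
  rewrite ltnW // ltnS ltnW // ltnS.
  apply: leq_trans (@leq_bigmax _ mz l).
  exact: (@leq_bigmax _ (fun k' : 'I_(size (G l)) => size ((G l)`_k')%R) (Ordinal ltk)).
pose w := zeta / (zeta - 1).
have w0 : w != 0 by rewrite mulf_neq0 ?invr_eq0.
pose Nt : {poly R[i]} := \prod_(1 <= j < n.+1) ('X - (q j)%:R%:P).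
pose Dt : {poly R[i]} := \prod_(1 <= j < n.+1) ('X + (p j)%:R%:P).
have NtE x : Nt.[x] = \prod_(1 <= j < n.+1) (x - (q j)%:R).
  by rewrite /Nt horner_prod; apply: eq_bigr => j _; rewrite !hornerE.
have DtE x : Dt.[x] = \prod_(1 <= j < n.+1) (x + (p j)%:R).
  by rewrite /Dt horner_prod; apply: eq_bigr => j _; rewrite !hornerE.
(* On top forms [U] is multiplication by [Nt / Dt]; the saddle point equation says that this equals
   [w] at [y]. *)
have Nty : Nt.[y] = w * Dt.[y].
  by rewrite NtE DtE /w mulrAC hy mulrAC divff // mul1r.
have Dty : Dt.[y] != 0.
  by apply: contraNneq hy0 => Dty0; rewrite -hy -DtE Dty0 mulr0.
(* At [q 1] the left side vanishes, while [Dt] is a product of positive numbers [q 1 + p j] and [w]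
   is nonzero. *)
have NtDt : Nt != w%:P * Dt.
  apply/eqP => /(congr1 (fun f => f.[(q 1%N)%:R])); rewrite hornerM hornerC NtE DtE.
  rewrite big_ltn // subrr mul0r => /esym/eqP; rewrite mulf_eq0 (negPf w0) /=.
  rewrite big_nat prodf_seq_eq0 => /hasP[j _ /andP[jn]].
  by rewrite -natrD pnatr_eq0 addn_eq0 => /andP[_]; rewrite -leqn0 leqNgt hp.
have tN : top_form (\sum_(1 <= j < n.+1) 1) Nt (numer R[i] n q 0%N).
  apply: top_form_prod => j; rewrite -['X]scale1r -polyCN; exact: top_form_affine.
have tD k : top_form (\sum_(1 <= j < n.+1) 1) Dt (denom R[i] n p k).
  apply: top_form_prod => j; rewrite -['X]scale1r; exact: top_form_affine.
pose b j := \sum_(l < n.+1) (map_poly (mobius_coef R[i] J.+1 j) (G l))%:P *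
               shift_ratio R[i] n p q l.
pose d := (\sum_(1 <= j < n.+1) (p j + q j) * n)%N.
pose At l : {poly R[i]} := \prod_(1 <= j < n.+1)
      (('X + (p j)%:R%:P) ^+ (p j * l) * ('X - (q j)%:R%:P) ^+ (q j * l) *
       (p j + q j)%:R%:P ^+ ((p j + q j) * (n - l))).
pose c := ((zeta - 1) ^+ J.+1)^-1.
have betaE : \sum_(j < J.+2) w%:P%:P ^+ j * b j =
    \sum_(l < n.+1) (c *: specz zeta (G l))%:P * shift_ratio R[i] n p q l.
  under eq_bigr do rewrite mulr_sumr.
  rewrite exchange_big; apply: eq_bigr => l _ /=.
  rewrite (@specz_mobius _ _ J.+1) // scalerA mulVf ?expf_neq0 // scale1r.
  rewrite rmorph_sum mulr_suml; apply: eq_bigr => j _ /=.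
  by rewrite mulrA -!polyC_exp -polyCM -[in RHS]mul_polyC.
have tb : top_form (tdeg G zeta + d)
    (\sum_(l < n.+1) (c * (specz zeta (G l))`_(tdeg G zeta))%:P * At l)
    (\sum_(j < J.+2) w%:P%:P ^+ j * b j).
  rewrite betaE; apply: top_form_sum => l; apply: top_formM.
    rewrite -coefZ; apply: top_formC; rewrite (leq_trans (size_scale_leq _ _)) //.
    by apply: leq_trans (leqSpred _); exact: leq_bigmax.
  by apply: top_form_shift_ratio; rewrite -ltnS.
have := top_form_vanishes (backshift_numer R[i] n q) (backshift_denom R[i] n p)
  tN tD NtDt Nty Dty (bin_prod_identity R[i] sG hGrec) tb.
(* The constant that clears the denominators of [v ^+ n]; the padding makes it common to all [l]. *)
pose e : R[i] := \prod_(1 <= j < n.+1) (p j + q j)%:R ^+ ((p j + q j) * n).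
have Aty (l : 'I_n.+1) : (At l).[y] = e * v ^+ l.
  rewrite hv -prodrXl /e -big_split horner_prod big_nat [RHS]big_nat.
  apply: eq_bigr => j jn; rewrite !hornerE.
  have pq0 : ((p j + q j)%:R : R[i]) != 0.
    by rewrite pnatr_eq0 -lt0n addn_gt0 hp.
  have -> : ((p j + q j) * n = (p j + q j) * l + (p j + q j) * (n - l))%N.
    by rewrite -mulnDr subnKC // -ltnS.
  rewrite exprD /= expr_div_n exprMn -!exprM.
  by field; rewrite expf_neq0.
have e0 : e != 0.
  rewrite /e big_nat prodf_seq_neq0; apply/allP => j _; apply/implyP => jn.
  by rewrite expf_neq0 // pnatr_eq0 -lt0n addn_gt0 hp.
have c0 : c != 0 by rewrite invr_eq0 expf_neq0.
(* The top form, which vanishes at [y], takes there the value [c * e] times the wanted sum. *)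
rewrite horner_sum => sum0; apply: (mulfI (mulf_neq0 c0 e0)).
rewrite mulr0 -[RHS]sum0 mulr_sumr; apply: eq_bigr => l _.
by rewrite hornerM hornerC Aty tleadE; ring.
Qed.
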